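(* Let $D_{m''}$ be the random directed graph defined below. Given a randomly chosen vertex $v$, the probability that a unique arc of $D_{m''}$ emanates from $v$ is no greater than $\frac{\log n}{n}$ as $n\to\infty$.
   Context: Let $KD_n$ be the complete directed graph on $\{1,\dots,n\}$ (all $n(n-1)$ arcs between distinct vertices). Take a uniformly random ordering $a_1,a_2,\dots$ of its arcs, let $D_m$ consist of the first $m$ arcs, and let $m''$ be the least $m$ such that every vertex of $D_m$ has in-degree at least $1$ and out-degree at least $1$ (the hitting-time setting of Frieze's theorem). *)

(* Defs.v *)
From mathcomp Require Import all_boot all_order all_algebra.
From mathcomp Require Import all_classical all_reals all_analysis.

Set Implicit Arguments.
Unset Strict Implicit.
Unset Printing Implicit Defensive.

Import Order.TTheory GRing.Theory Num.Theory.
Local Open Scope ring_scope.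

(* The arcs of KD_n; the vertices are 0, ..., n - 1 instead of 1, ..., n. *)
Definition arc (n : nat) : finType := {a : 'I_n * 'I_n | a.1 != a.2}.

Definition tail (n : nat) (a : arc n) : 'I_n := (val a).1.
Definition head (n : nat) (a : arc n) : 'I_n := (val a).2.

Definition outdeg (n : nat) (D : {set arc n}) (v : 'I_n) : nat :=
  #|[set a in D | tail a == v]|.
Definition indeg (n : nat) (D : {set arc n}) (v : 'I_n) : nat :=
  #|[set a in D | head a == v]|.

(* A duplicate-free tuple of length #|arc n| lists every arc exactly once. *)
Definition arc_order (n : nat) : finType :=
  {s : #|{: arc n}|.-tuple (arc n) | uniq s}.

Definition digraph_at (n : nat) (s : arc_order n) (m : nat) : {set arc n} :=
  [set a in take m (val s)].

Definition min_in_out_degree_ge1 (n : nat) (D : {set arc n}) : bool :=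
  [forall v, (1 <= indeg D v)%N && (1 <= outdeg D v)%N].

(* The least m with the required property; [hitting_timeP] shows that such an
   m exists as soon as n >= 2. *)
Definition hitting_time (n : nat) (s : arc_order n) : nat :=
  find (fun m => min_in_out_degree_ge1 (digraph_at s m))
       (iota 0 #|{: arc n}|.+1).

Definition hitting_digraph (n : nat) (s : arc_order n) : {set arc n} :=
  digraph_at s (hitting_time s).

Definition uniform_prob (R : realType) (T : finType) (A : {set T}) : R :=
  #|A|%:R / #|T|%:R.

(* The ordering and the vertex are independent and uniformly distributed. *)
Definition prob_unique_out_arc (R : realType) (n : nat) : R :=
  uniform_prob R
    [set w : arc_order n * 'I_n | outdeg (hitting_digraph w.1) w.2 == 1%N].

Lemma digraph_at_all (n : nat) (s : arc_order n) :
  digraph_at s #|{: arc n}| = [set: arc n].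
Proof.
have sz : size (val (val s)) = #|{: arc n}| by rewrite size_tuple.
have sub : {subset val (val s) <= enum (arc n)} by move=> b _; rewrite mem_enum.
have le_sz : (size (enum (arc n)) <= size (val (val s)))%N.
  by rewrite sz -cardE.
have [_ eqs] := uniq_min_size (valP s) sub le_sz.
apply/setP => a; rewrite !inE take_oversize ?sz //.
by rewrite -[LHS]/(a \in val (val s)) eqs mem_enum.
Qed.

Lemma hitting_timeP (n : nat) (s : arc_order n) : (2 <= n)%N ->
  [/\ (hitting_time s <= #|{: arc n}|)%N,
      min_in_out_degree_ge1 (hitting_digraph s) &
      forall m, min_in_out_degree_ge1 (digraph_at s m) ->
        (hitting_time s <= m)%N].
Proof.
move=> n2; set P := fun m => min_in_out_degree_ge1 (digraph_at s m).
have Pall : P #|{: arc n}|.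
  rewrite /P digraph_at_all; apply/forallP => v.
  have [u uv] : exists u : 'I_n, u != v.
    have : (0 < #|predC1 v|)%N by rewrite cardC1 card_ord; case: n n2 {s P v} => [|[]].
    by case/card_gt0P => u; exists u.
  have vu : v != u by rewrite eq_sym.
  apply/andP; split; apply/card_gt0P.
  - by exists (exist _ (u, v) uv); rewrite !inE /head /=.
  - by exists (exist _ (v, u) vu); rewrite !inE /tail /=.
have hasP : has P (iota 0 #|{: arc n}|.+1).
  by apply/hasP; exists #|{: arc n}| => //; rewrite mem_iota /= add0n.
have le_ht : (hitting_time s <= #|{: arc n}|)%N.
  by move: hasP; rewrite has_find size_iota ltnS.
split=> //.
  by have := nth_find 0%N hasP; rewrite nth_iota.
move=> m Pm; rewrite leqNgt; apply/negP => lt_m.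
have := before_find 0%N lt_m.
rewrite nth_iota ?add0n ?Pm //.
exact: ltn_trans lt_m _.
Qed.

(* Main.v *)
(* Reveal the arcs one at a time and let a, b and x be the numbers of vertices of
   out-degree 0, of in-degree 0 and of out-degree 1.  A vertex of out-degree 1
   keeps it until the hitting time if each of the r = a + b uncovered "slots"
   (one for leaving, one for entering) is covered before its next out-arc
   appears, which by near exchangeability has probability about 1 / (r + 1); and
   the next slot to be covered is a leaving one with probability a / r.  So
   x / (r + 1) + (a / r) H_r, corrected by terms of order (x + a) / n, is a
   supermartingale.  It dominates x at the hitting time, where r = 0, and starts
   at H_{2n} / 2 + O(1), which is eventually below log n. *)
Require Import Defs.
From mathcomp Require Import all_boot all_order all_algebra.
From mathcomp Require Import all_classical all_reals all_analysis.
From mathcomp Require Import perm ring lra zify.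
Import Order.TTheory GRing.Theory Num.Theory.
(* mathcomp's path.v and seq.v have their own [arc] and [head]. *)
Import Defs.
Local Open Scope ring_scope.

(** * Exchangeability of positions in a random arc order *)

Lemma card_ord_ge (m i : nat) : #|[pred j : 'I_m | (i <= j)%N]| = (m - i)%N.
Proof.
rewrite -sum1_card (eq_bigl (fun j : 'I_m => (i <= j)%N)) //.
elim: m => [|m IH]; first by rewrite big_ord0.
by rewrite big_mkcond big_ord_recr /= -big_mkcond IH; case: leqP; lia.
Qed.

Lemma in_digraph_at {n : nat} (s : arc_order n) (m : nat) (j : 'I_#|{: arc n}|) :
  (tnth (val s) j \in digraph_at s m) = (j < m)%N.
Proof.
rewrite inE /= in_take ?mem_tnth //.
rewrite (tnth_nth (tnth (val s) j)) index_uniq ?size_tuple //.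
exact: (valP s).
Qed.

Lemma arc_order_tnth_bij {n : nat} (s : arc_order n) : bijective (tnth (val s)).
Proof.
apply: inj_card_bij; last by rewrite card_ord.
by apply/tuple_uniqP; exact: (valP s).
Qed.

Lemma swap_positions_uniq {n : nat} (i j : 'I_#|{: arc n}|) (s : arc_order n) :
  uniq [tuple tnth (val s) (tperm i j k) | k < #|{: arc n}|].
Proof.
apply/tuple_uniqP => k l; rewrite !tnth_mktuple.
by move/(bij_inj (arc_order_tnth_bij s))/perm_inj.
Qed.

Definition swap_positions {n : nat} (i j : 'I_#|{: arc n}|) (s : arc_order n) :
  arc_order n := exist (fun t => is_true (uniq (val t))) _ (swap_positions_uniq i j s).

Lemma tnth_swap_positions {n : nat} (i j k : 'I_#|{: arc n}|) (s : arc_order n) :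
  tnth (val (swap_positions i j s)) k = tnth (val s) (tperm i j k).
Proof. by rewrite tnth_mktuple. Qed.

Lemma swap_positionsK {n : nat} (i j : 'I_#|{: arc n}|) :
  involutive (swap_positions i j).
Proof.
move=> s; apply/val_inj/eq_from_tnth => k.
by rewrite !tnth_swap_positions tpermK.
Qed.

Lemma digraph_at_swap_positions {n : nat} (i j : 'I_#|{: arc n}|)
    (s : arc_order n) (m : nat) :
  (m <= i)%N -> (m <= j)%N -> digraph_at (swap_positions i j s) m = digraph_at s m.
Proof.
move=> mi mj; apply/setP => e.
have [g _ gK] := arc_order_tnth_bij s.
rewrite -(gK e) in_digraph_at -{1}[g e](tpermK i j) -tnth_swap_positions.
by rewrite in_digraph_at; case: tpermP => // ->; rewrite !ltnNge mi mj.
Qed.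

Lemma digraph_atS {n : nat} (s : arc_order n) (i : 'I_#|{: arc n}|) :
  digraph_at s i.+1 = tnth (val s) i |: digraph_at s i.
Proof.
apply/setP => e; have [g _ gK] := arc_order_tnth_bij s.
rewrite in_setU1 -(gK e) !in_digraph_at (bij_eq (arc_order_tnth_bij s)).
by rewrite ltnS leq_eqVlt.
Qed.

(* The arc after the first i is uniform among the others, because swapping the
   positions i and j >= i keeps the first i arcs. *)
Lemma sum_next_arc {R : realType} {n : nat} (i : 'I_#|{: arc n}|)
    (G : {set arc n} -> arc n -> R) :
  \sum_(s : arc_order n) \sum_(e in ~: digraph_at s i) G (digraph_at s i) e =
  (#|{: arc n}| - i)%:R *
    \sum_(s : arc_order n) G (digraph_at s i) (tnth (val s) i).
Proof.
have reorder (s : arc_order n) :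
    \sum_(e in ~: digraph_at s i) G (digraph_at s i) e =
    \sum_(j < #|{: arc n}| | (i <= j)%N) G (digraph_at s i) (tnth (val s) j).
  rewrite (reindex (tnth (val s))); last exact/onW_bij/arc_order_tnth_bij.
  by apply: eq_bigl => j; rewrite finset.in_setC in_digraph_at -leqNgt.
rewrite (eq_bigr _ (fun s _ => reorder s)) exchange_big /=.
rewrite (eq_bigr (fun=> \sum_(s : arc_order n)
                          G (digraph_at s i) (tnth (val s) i))); last first.
  move=> j ij; rewrite (reindex_inj (inv_inj (swap_positionsK i j))) /=.
  apply: eq_bigr => s _.
  by rewrite digraph_at_swap_positions // tnth_swap_positions tpermR.
rewrite sumr_const mulr_natl; congr (_ *+ _).
exact: card_ord_ge.
Qed.


(** * Optional stopping at the hitting time *)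

Lemma min_in_out_degree_ge1S {n : nat} (D D' : {set arc n}) :
  D \subset D' -> min_in_out_degree_ge1 D -> min_in_out_degree_ge1 D'.
Proof.
move=> /fintype.subsetP sDD' /forallP hD; apply/forallP => v.
have /andP[hi ho] := hD v; apply/andP; split.
- apply: leq_trans hi _; apply/subset_leq_card/fintype.subsetP => e.
  by rewrite !finset.inE => /andP[/sDD' -> ->].
- apply: leq_trans ho _; apply/subset_leq_card/fintype.subsetP => e.
  by rewrite !finset.inE => /andP[/sDD' -> ->].
Qed.

(** The degree condition is monotone in the arc set, so the first [m] arcs alone decide whether the
    process has stopped by time [m]. *)
Lemma hitting_time_le {n : nat} (s : arc_order n) (m : nat) : (2 <= n)%N ->
  (hitting_time s <= m)%N = min_in_out_degree_ge1 (digraph_at s m).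
Proof.
move=> n2; have [_ hD hmin] := hitting_timeP s n2.
apply/idP/idP => [lm|/hmin//]; apply: min_in_out_degree_ge1S hD.
apply/fintype.subsetP => e.
have [g _ gK] := arc_order_tnth_bij s.
by rewrite -(gK e) !in_digraph_at => /leq_trans; apply.
Qed.

Lemma card_digraph_atC {n : nat} (s : arc_order n) (i : 'I_#|{: arc n}|) :
  #|~: digraph_at s i| = (#|{: arc n}| - i)%N.
Proof.
rewrite -card_ord_ge -(fintype.card_image (bij_inj (arc_order_tnth_bij s))).
apply: eq_card => e; have [g _ gK] := arc_order_tnth_bij s.
rewrite finset.in_setC -(gK e) in_digraph_at -leqNgt.
by rewrite fintype.mem_image //; exact/bij_inj/arc_order_tnth_bij.
Qed.

(* Optional stopping for a supermartingale indexed by the arc sets. *)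
Lemma sum_hitting_digraph_le {R : realType} {n : nat} (Phi : {set arc n} -> R) :
  (2 <= n)%N ->
  (forall D, ~~ min_in_out_degree_ge1 D ->
     \sum_(e in ~: D) (Phi (e |: D) - Phi D) <= 0) ->
  \sum_(s : arc_order n) Phi (hitting_digraph s) <=
    #|{: arc_order n}|%:R * Phi finset.set0.
Proof.
move=> n2 hPhi.
pose stopped m (s : arc_order n) := digraph_at s (minn m (hitting_time s)).
have step m : (m <= #|{: arc n}|)%N ->
    \sum_s Phi (stopped m s) <= #|{: arc_order n}|%:R * Phi finset.set0.
  elim: m => [_|m IH mM].
    rewrite (eq_bigr (fun=> Phi finset.set0)); first by rewrite sumr_const mulr_natl lexx.
    move=> s _; rewrite /stopped min0n; congr Phi.
    by apply/setP => e; rewrite !finset.inE take0.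
  apply: le_trans (IH (ltnW mM)).
  rewrite -subr_le0 -sumrB.
  (* The factor [bad D] freezes the process after stopping. It depends only on the current arc set,
     so the increment has the form that [sum_next_arc] averages. *)
  pose i := Ordinal mM; pose bad (D : {set arc n}) := ~~ min_in_out_degree_ge1 D.
  rewrite (eq_bigr (fun s => (fun D e => (Phi (e |: D) - Phi D) *+ bad D)
                               (digraph_at s i) (tnth (val s) i))); last first.
    move=> s _; rewrite /stopped /bad -hitting_time_le // -ltnNge /=.
    case: (ltnP m (hitting_time s)) => hm.
      by rewrite (minn_idPl hm) (digraph_atS s i).
    by rewrite (minn_idPr (leqW hm)) subrr.
  rewrite -(@pmulr_rle0 _ (#|{: arc n}| - i)%:R); last by rewrite ltr0n subn_gt0.
  rewrite -(sum_next_arc i (fun D e => (Phi (e |: D) - Phi D) *+ bad D)).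
  apply: sumr_le0 => s _; rewrite sumrMnl /bad.
  by case: (boolP (min_in_out_degree_ge1 _)) => //= /hPhi.
apply: le_trans (step _ (leqnn _)); apply: ler_sum => s _.
by rewrite /stopped (minn_idPr _) //; case: (hitting_timeP s n2).
Qed.

(** * Degree counts and their change when an arc is added *)

Lemma card_tail_eq {n : nat} (v : 'I_n) : #|[set e : arc n | tail e == v]| = n.-1.
Proof.
rewrite -[in RHS](card_ord n) -(cardC1 v).
rewrite -(card_in_imset (f := @head n)); last first.
  move=> e f; rewrite !finset.inE => /eqP et /eqP ft ef.
  apply/val_inj; move: et ft ef; rewrite /tail /head.
  by case: (val e) (val f) => [? ?] [? ?] /= -> -> ->.
apply: eq_card => w; apply/imsetP/idP => [[e]|].
  by rewrite !finset.inE => /eqP <- ->; rewrite eq_sym; exact: (valP e).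
rewrite inE eq_sym => vw; exists (exist (fun a => is_true (a.1 != a.2)) (v, w) vw) => //.
by rewrite finset.inE /tail /=.
Qed.

Lemma card_head_eq {n : nat} (v : 'I_n) : #|[set e : arc n | head e == v]| = n.-1.
Proof.
rewrite -[in RHS](card_ord n) -(cardC1 v).
rewrite -(card_in_imset (f := @tail n)); last first.
  move=> e f; rewrite !finset.inE => /eqP et /eqP ft ef.
  apply/val_inj; move: et ft ef; rewrite /tail /head.
  by case: (val e) (val f) => [? ?] [? ?] /= -> -> ->.
apply: eq_card => w; apply/imsetP/idP => [[e]|].
  by rewrite !finset.inE => /eqP <- ->; exact: (valP e).
rewrite inE => vw; exists (exist (fun a => is_true (a.1 != a.2)) (w, v) vw) => //.
by rewrite finset.inE /head /=.
Qed.

(* With h = tail (resp. head) this is the set of the vertices of out-degree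
   (resp. in-degree) k. *)
Definition degree_set {T V : finType} (h : T -> V) (D : {set T}) (k : nat) : {set V} :=
  [set v | #|[set a in D | h a == v]| == k].

Lemma fiberU1 {T V : finType} (h : T -> V) (D : {set T}) (e : T) (v : V) : e \notin D ->
  #|[set a in e |: D | h a == v]| = ((h e == v) + #|[set a in D | h a == v]|)%N.
Proof.
move=> eD.
have -> : [set f in e |: D | h f == v] =
    [set f in [set e] | h f == v] :|: [set f in D | h f == v].
  by apply/setP => f; rewrite !finset.inE andb_orl.
rewrite cardsU (_ : _ :&: _ = finset.set0) ?cards0 ?subn0; last first.
  apply/setP => f; rewrite !finset.inE; case: eqP => //= ->.
  by rewrite (negbTE eD) andbF.
congr addn; case: (boolP (h e == v)) => ev.
  by rewrite /= -(cards1 e); apply: eq_card => f; rewrite !finset.inE; case: eqP => // ->.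
by apply: eq_card0 => f; rewrite !finset.inE; case: eqP => // ->; exact/negbTE.
Qed.

Lemma card_degree_set0U1 {T V : finType} (h : T -> V) (D : {set T}) (e : T) : e \notin D ->
  #|degree_set h D 0| = ((h e \in degree_set h D 0) + #|degree_set h (e |: D) 0|)%N.
Proof.
move=> eD; rewrite (cardsD1 (h e)); congr addn; apply: eq_card => v.
by rewrite !finset.inE fiberU1 // addn_eq0 eqb0 eq_sym.
Qed.

(** Only the degree of [h e] changes, so that vertex is split off on both sides. The additive form
    avoids truncated subtraction. *)
Lemma card_degree_set1U1 {T V : finType} (h : T -> V) (D : {set T}) (e : T) : e \notin D ->
  ((h e \in degree_set h D 1) + #|degree_set h (e |: D) 1| =
   (h e \in degree_set h D 0) + #|degree_set h D 1|)%N.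
Proof.
move=> eD; rewrite (cardsD1 (h e) (degree_set h D 1)).
rewrite (cardsD1 (h e) (degree_set h (e |: D) 1)) addnCA.
congr (_ + (_ + _))%N; first by rewrite !finset.inE fiberU1 // eqxx.
apply: eq_card => v; rewrite !finset.inE fiberU1 // eq_sym.
by case: (_ == _).
Qed.

Lemma card_degree_set_arcs {T V : finType} (h : T -> V) (D : {set T}) (N k : nat) :
  (forall v, #|[set a | h a == v]| = N) ->
  #|[set e in ~: D | h e \in degree_set h D k]| = (#|degree_set h D k| * (N - k))%N.
Proof.
move=> hN.
rewrite -sum1_card (partition_big h (fun v => v \in degree_set h D k)) /=; last first.
  by move=> e; rewrite !finset.inE => /andP[].
rewrite -sum_nat_const; apply: eq_bigr => v; rewrite finset.inE => /eqP dv.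
rewrite -(hN v) -{}dv -(cardsID D [set e | h e == v]) sum1_card.
rewrite (_ : #|[set e | h e == v] :&: D| = #|[set a in D | h a == v]|).
  rewrite addKn; apply: eq_card => e; rewrite !finset.inE unfold_in /= !finset.inE.
  by case: (h e =P v) => [->|]; rewrite ?andbF // eqxx !andbT.
by apply: eq_card => e; rewrite !finset.inE andbC.
Qed.

Lemma card_tail_head_le {n : nat} (D : {set arc n}) (A B : {set 'I_n}) :
  (#|[set e in ~: D | (tail e \in A) && (head e \in B)]| <= #|A| * #|B|)%N.
Proof.
rewrite -cardsX -(card_imset _ val_inj); apply/subset_leq_card/fintype.subsetP.
by move=> _ /imsetP[e + ->]; rewrite !finset.inE => /andP[_].
Qed.

(** * Harmonic sums, the potential and its drift *)

Definition harmonic_sum (R : realType) (m : nat) : R := \sum_(i < m) i.+1%:R^-1.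

Lemma harmonic_sumS {R : realType} (m : nat) :
  harmonic_sum R m.+1 = harmonic_sum R m + m.+1%:R^-1.
Proof. by rewrite /harmonic_sum big_ord_recr. Qed.

Lemma harmonic_sum0 {R : realType} : harmonic_sum R 0 = 0.
Proof. exact: big_ord0. Qed.

Lemma harmonic_sum_le {R : realType} (m : nat) : harmonic_sum R m <= m%:R.
Proof.
elim: m => [|m IH]; first by rewrite harmonic_sum0.
by rewrite harmonic_sumS -[in leRHS]natr1 lerD // invf_le1 ?ltr0n // ler1n.
Qed.

Lemma harmonic_sum_ge1 {R : realType} (m : nat) : 1 <= harmonic_sum R m.+1.
Proof.
by rewrite /harmonic_sum big_ord_recl invr1 lerDl sumr_ge0.
Qed.

(* a, b and x are the numbers of vertices of out-degree 0, of in-degree 0 and of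
   out-degree 1; N = n - 1.  For the ideal process in which the uncovered slots
   are exchangeable, x / (a + b + 1) + a / (a + b) * H_(a + b) is the exact
   conditional expectation of the final value of x.  The terms in (N - 1)^-1 and
   N^-1 absorb the defects: a vertex of out-degree 1 has only N - 1 unused
   out-arcs, and one arc may cover two slots. *)
Definition potential {R : realType} (N : R) (a b : nat) (x : R) : R :=
  x * ((a + b)%:R + 1)^-1 + x * (N - 1)^-1 +
  a%:R * (harmonic_sum R (a + b) / (a + b)%:R + (N - 1)^-1 + 2 / N).

(** Here u = a - 1, v = b - 1, and [H] stands for H_(a + b - 2). The main harmonic terms cancel
    exactly, and what is left is affine in [x]. The terms in (N - 1)^-1 contribute -x, and the term
    2 / N contributes -2 (u + 1). These pay for the contributions of the [d] arcs that cover two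
    slots at once. *)
Lemma potential_drift_large {R : realType} (N u v x d H : R) :
  2 <= N -> 0 <= u -> 0 <= v -> 1 <= u + v -> 0 <= x -> 0 <= d ->
  d <= (u + 1) * (v + 1) -> 1 <= H -> H <= u + v ->
  let r := u + v + 2 in
  let f k := k^-1 + (N - 1)^-1 in
  let K := (N - 1)^-1 + 2 / N in
  let H1 := H + (r - 1)^-1 in
  let H0 := H1 + r^-1 in
  let alpha := (x + 1) * f r + u * (H1 / (r - 1) + K)
               - (x * f (r + 1) + (u + 1) * (H0 / r + K)) in
  let beta := x * f r + (u + 1) * (H1 / (r - 1) + K)
               - (x * f (r + 1) + (u + 1) * (H0 / r + K)) in
  let both := (x + 1) * f (r - 1) + u * (H / (r - 2) + K)
               - (x * f (r + 1) + (u + 1) * (H0 / r + K)) in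
  (u + 1) * N * alpha + (v + 1) * N * beta + d * (both - alpha - beta)
    - x * (N - 1) * f (r + 1) <= 0.
Proof.
move=> N2 u0 v0 uv1 x0 d0 dle H1 Huv /=.
set s := u + v in uv1 Huv *.
have sE : s = u + v by [].
have dquad : 4 * ((u + 1) * (v + 1)) <= (s + 2) ^+ 2.
  by rewrite -subr_ge0 (_ : _ - _ = (u - v) ^+ 2) ?sqr_ge0 // /s; ring.
set P := (1 + 2 * d / ((s + 2) * (s + 1))) / (s + 3) - 1.
(* With H_s = [H], [c2] is the second difference of H_k / k over k = s, s + 1, s + 2, and [c1] is
   its decrease from s to s + 1. *)
set c2 := (H + (s + 1)^-1) * 2 / ((s + 2) * (s + 1) * s)
          + (s + 2)^-1 ^+ 2 - ((s + 1) * s)^-1.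
set c1 := (H - s / (s + 1)) / ((s + 1) * s).
set Q := d * (((s + 2) * (s + 1))^-1 + (u + 1) * c2 - c1) - 2 * (u + 1).
rewrite [leLHS](_ : _ = x * P + Q); last first.
  rewrite /P /Q /c1 /c2 /s; field.
  by rewrite !lt0r_neq0 //; lra.
have P0 : P <= 0.
  rewrite /P subr_le0 ler_pdivrMr; last by lra.
  have : 2 * d / ((s + 2) * (s + 1)) <= 1.
    by rewrite ler_pdivrMr; [nra|apply: mulr_gt0; lra].
  lra.
have c2le : c2 <= 2 / ((s + 2) * s).
  rewrite -subr_ge0 /c2.
  rewrite (_ : _ - _ = ((s + 1 - H) * 2 * (s + 2) * (s + 1)
      + (3 * s + 4) * (s + 1) - 2 * (s + 2))
      / ((s + 2) ^+ 2 * (s + 1) ^+ 2 * s)).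
    apply: divr_ge0; nra.
  field.
  by rewrite !lt0r_neq0 //; lra.
have c1ge : 0 <= c1.
  rewrite /c1 divr_ge0 //; last by apply: mulr_ge0; lra.
  by rewrite subr_ge0 ler_pdivrMr; nra.
rewrite -[leRHS]addr0 lerD //; first by rewrite mulr_ge0_le0.
(* The bounds 1/2 and 3/2 add up to the 2 in the term 2 / N of [potential]; the second one uses
   [dquad] and s >= 1. *)
have sum_le : (v + 1) * (((s + 2) * (s + 1))^-1 + (u + 1) * (2 / ((s + 2) * s))) <= 2.
  have : (v + 1) / ((s + 2) * (s + 1)) <= 1 / 2.
    by rewrite ler_pdivrMr; [nra|apply: mulr_gt0; lra].
  have : 2 * ((u + 1) * (v + 1)) / ((s + 2) * s) <= 3 / 2.
    by rewrite ler_pdivrMr; [nra|apply: mulr_gt0; lra].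
  lra.
have inv0 : 0 <= ((s + 2) * (s + 1))^-1 by rewrite invr_ge0 mulr_ge0 //; lra.
have inv1 : 0 <= 2 / ((s + 2) * s) by rewrite divr_ge0 // mulr_ge0 //; lra.
(* The sign of [t] is not known, so it is replaced by t' >= 0 before [d] is enlarged to (u + 1) (v +
   1). *)
rewrite /Q subr_le0; set t := _ + _ - c1.
set t' := _^-1 + _ in sum_le.
have tt' : t <= t'.
  rewrite /t lerBlDr; apply: (@le_trans _ _ t'); last by rewrite lerDl.
  by apply: lerD => //; apply: ler_wpM2l => //; lra.
have t'0 : 0 <= t' by rewrite addr_ge0 // mulr_ge0 //; lra.
apply: (@le_trans _ _ ((u + 1) * (v + 1) * t')).
  by apply: le_trans (ler_wpM2l d0 tt') _; exact: ler_wpM2r.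
rewrite -mulrA mulrC; apply: ler_wpM2r => //; lra.
Qed.

Lemma potential_drift {R : realType} (N : R) (a b : nat) (x d : R) :
  2 <= N -> 0 <= x -> 0 <= d -> d <= a%:R * b%:R -> (0 < a + b)%N ->
  a%:R * N * (potential N a.-1 b (x + 1) - potential N a b x) +
  b%:R * N * (potential N a b.-1 x - potential N a b x) +
  d * (potential N a.-1 b.-1 (x + 1) - potential N a.-1 b (x + 1)
       - potential N a b.-1 x + potential N a b x)
  - x * (N - 1) * (((a + b)%:R + 1)^-1 + (N - 1)^-1) <= 0.
Proof.
move=> N2 x0 d0; case: a b => [|a] [|b] //= dle _; rewrite ?mul0r ?mulr0 in dle.
- have -> : d = 0 by apply/eqP; rewrite eq_le dle d0.
  rewrite /potential !add0n /= !mul0r -!natr1; have : 0 <= b%:R :> R by rewrite ler0n.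
  move: (b%:R : R) => v v0.
  rewrite [leLHS](_ : _ = - x * (v + 1) / (v + 2)).
    by rewrite mulNr mulNr oppr_le0 divr_ge0 ?mulr_ge0 //; lra.
  by field; rewrite !lt0r_neq0 //; lra.
- have -> : d = 0 by apply/eqP; rewrite eq_le dle d0.
  rewrite /potential !addn0 harmonic_sumS -!natr1; set u : R := a%:R; rewrite /= !mul0r.
  have u0 : 0 <= u by rewrite ler0n.
  (* This holds also at u = 0, since H_0 = 0 and division by zero gives 0. *)
  have : u * (harmonic_sum R a / u) = harmonic_sum R a.
    case: (ltngtP a 0) => // [a0|a0]; last by rewrite /u a0 harmonic_sum0 mul0r.
    by rewrite mulrC divfK // pnatr_eq0 -lt0n.
  move: (harmonic_sum R a / u) => h.
  move: (harmonic_sum R a) u u0 => H u u0 hE.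
  rewrite [leLHS](_ : _ = - x * (u + 1) / (u + 2) - 2 * (u + 1)
                          + (u + 1) * N * (u * h - H)).
    rewrite hE subrr mulr0 addr0 !mulNr -opprD oppr_le0.
    by rewrite addr_ge0 ?divr_ge0 ?mulr_ge0 //; lra.
  by field; rewrite !lt0r_neq0 //; lra.
(* [a] and [b] are now the predecessors. One slot of each kind is treated apart because
   [potential_drift_large] divides by a + b. *)
- have [ab|ab] := posnP (a + b).
    have [a0 b0] : a = 0%N /\ b = 0%N by lia.
    move: dle; rewrite a0 b0 /potential /= !addn0 !harmonic_sumS harmonic_sum0 mulr1 !mul0r => dle.
    have xd : x * ((d - 2) / 3) <= 0 by apply: mulr_ge0_le0 => //; lra.
    rewrite [leLHS](_ : _ = x * ((d - 2) / 3) + (d / 4 - 2)); first by lra.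
    by field; rewrite !lt0r_neq0 //; lra.
  rewrite /potential !addSn !addnS !harmonic_sumS.
  move: dle; rewrite -!natr1 natrD.
  have : 1 <= harmonic_sum R (a + b) by case: (a + b)%N ab => // m _; exact: harmonic_sum_ge1.
  have := @harmonic_sum_le R (a + b).
  have : 1 <= (a + b)%:R :> R by rewrite ler1n.
  rewrite natrD.
  have : 0 <= b%:R :> R by rewrite ler0n.
  have : 0 <= a%:R :> R by rewrite ler0n.
  move: (a%:R : R) (b%:R : R) (harmonic_sum R (a + b)) => u v H.
  move=> u0 v0 uv1 Huv H1 dle.
  have /= := potential_drift_large N u v x d H N2 u0 v0 uv1 x0 d0 dle H1 Huv.
  apply: le_trans.
  rewrite le_eqVlt; apply/orP; left; apply/eqP => /=; field.
  by rewrite !lt0r_neq0 //; lra.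
Qed.

(** The indicators make the bound summable over arcs by counting. It is an equality unless [t1] and
    [h0] both hold; then the lost vertex of out-degree 1 is weighted by the new, smaller a + b, so
    the true loss is at least the one recorded. *)
Lemma potential_increment_le {R : realType} (N : R) (a b a' b' x x' : nat)
    (t0 t1 h0 : bool) :
  1 < N -> a = (t0 + a')%N -> b = (h0 + b')%N -> (t1 + x' = t0 + x)%N ->
  ~~ (t0 && t1) ->
  potential N a' b' x'%:R - potential N a b x%:R <=
  t0%:R * (potential N a.-1 b (x%:R + 1) - potential N a b x%:R) +
  h0%:R * (potential N a b.-1 x%:R - potential N a b x%:R) +
  (t0 && h0)%:R * (potential N a.-1 b.-1 (x%:R + 1) - potential N a.-1 b (x%:R + 1)
       - potential N a b.-1 x%:R + potential N a b x%:R)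
  - t1%:R * (((a + b)%:R + 1)^-1 + (N - 1)^-1).
Proof.
move=> N1 -> -> xx' t01.
have : t1%:R + x'%:R = t0%:R + x%:R :> R by rewrite -!natrD xx'.
case: t0 t1 h0 t01 {xx'} => [] [] [] //= _ xx'; rewrite ?add0n ?add1n /=.
- by rewrite (_ : x'%:R = x%:R + 1 :> R); lra.
- by rewrite (_ : x'%:R = x%:R + 1 :> R); lra.
- rewrite (_ : x'%:R = x%:R - 1 :> R); last by lra.
  have le_inv : ((a' + b'.+1)%:R + 1)^-1 <= ((a' + b')%:R + 1)^-1 :> R.
    by rewrite lef_pV2 ?posrE ?natr1 ?ltr0n // ler_nat; lia.
  rewrite [in leLHS]/potential [X in _ <= X - _](_ : _ =
    potential N a' b' x%:R - potential N a' b'.+1 x%:R); last by ring.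
  rewrite [in leRHS]/potential; lra.
- rewrite (_ : x'%:R = x%:R - 1 :> R); last by lra.
  rewrite /potential; lra.
- by rewrite (_ : x'%:R = x%:R :> R); lra.
- by rewrite (_ : x'%:R = x%:R :> R); lra.
Qed.

(** * The potential as a supermartingale on arc sets *)

Lemma sum_indicator {R : realType} {T : finType} (A : {set T}) (P : pred T) :
  \sum_(e in A) (P e)%:R = #|[set e in A | P e]|%:R :> R.
Proof.
rewrite -sum1_card natr_sum (eq_bigl (fun e => (e \in A) && P e)).
  by rewrite big_mkcondr; apply: eq_bigr => e _; case: (P e).
by move=> e; rewrite finset.inE.
Qed.

Lemma degree_set_empty {T V : finType} (h : T -> V) (k : nat) :
  degree_set h finset.set0 k = if k == 0%N then finset.setT else finset.set0.
Proof.
apply/setP => v; rewrite finset.inE (_ : #|_| = 0%N).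
  by case: k => [|k]; rewrite !finset.inE.
by apply: eq_card0 => e; rewrite !finset.inE.
Qed.

Definition arc_potential {R : realType} {n : nat} (D : {set arc n}) : R :=
  potential n.-1%:R #|degree_set (@tail n) D 0| #|degree_set (@head n) D 0|
    #|degree_set (@tail n) D 1|%:R.

Lemma arc_potential_drift {R : realType} {n : nat} (D : {set arc n}) : (3 <= n)%N ->
  ~~ min_in_out_degree_ge1 D ->
  \sum_(e in ~: D) (arc_potential (e |: D) - arc_potential D) <= 0 :> R.
Proof.
move=> n3 bad.
set A := degree_set (@tail n) D 0; set B := degree_set (@head n) D 0.
set X := degree_set (@tail n) D 1.
have AB : (0 < #|A| + #|B|)%N.
  rewrite lt0n; apply: contra bad; rewrite addn_eq0 !cards_eq0 => /andP[/eqP A0 /eqP B0].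
  apply/forallP => v; rewrite !lt0n.
  have : v \notin A by rewrite A0 finset.inE.
  have : v \notin B by rewrite B0 finset.inE.
  by rewrite !finset.inE => -> ->.
have N2 : 2 <= n.-1%:R :> R by rewrite ler_nat; lia.
pose d := #|[set e in ~: D | (tail e \in A) && (head e \in B)]|.
have dle : d%:R <= #|A|%:R * #|B|%:R :> R.
  by rewrite -natrM ler_nat card_tail_head_le.
apply: le_trans (potential_drift n.-1%:R #|A| #|B| #|X|%:R d%:R N2
  (ler0n _ _) (ler0n _ _) dle AB).
apply: (@le_trans _ _ _ _ _ (ler_sum _ (fun e eD => @potential_increment_le R n.-1%:R #|A| #|B|
  #|degree_set (@tail n) (e |: D) 0| #|degree_set (@head n) (e |: D) 0| #|X|
  #|degree_set (@tail n) (e |: D) 1| (tail e \in A) (tail e \in X) (head e \in B) _ _ _ _ _))).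
- by move=> *; lra.
- by move=> e; rewrite finset.in_setC => /card_degree_set0U1 ->.
- by move=> e; rewrite finset.in_setC => /card_degree_set0U1 ->.
- by move=> e; rewrite finset.in_setC => /card_degree_set1U1.
- by move=> e _; rewrite !finset.inE; case: #|_| => [|[]].
rewrite sumrB !big_split /= -!mulr_suml !sum_indicator.
rewrite (card_degree_set_arcs _ _ _ _ card_tail_eq) (card_degree_set_arcs _ _ _ _ card_head_eq).
rewrite (card_degree_set_arcs _ _ _ _ card_tail_eq) !subn0 subn1 !natrM -/A -/B -/X -/d.
by rewrite -(subn1 n.-1) natrB ?lexx //; lia.
Qed.

(** * The probability bound and its asymptotics *)

Lemma prob_unique_out_arcE {R : realType} (n : nat) :
  prob_unique_out_arc R n =
  (\sum_(s : arc_order n) #|degree_set (@tail n) (hitting_digraph s) 1|%:R)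
    / (#|{: arc_order n}|%:R * n%:R).
Proof.
rewrite /prob_unique_out_arc /uniform_prob card_prod card_ord natrM; congr (_ / _).
rewrite -natr_sum; congr (_%:R).
rewrite -sum1dep_card (eq_bigr (fun s => \sum_(v | outdeg (hitting_digraph s) v == 1%N) 1)%N).
  by rewrite pair_big_dep.
by move=> s _; rewrite sum1dep_card.
Qed.

Lemma prob_unique_out_arc_le {R : realType} (n : nat) : (3 <= n)%N ->
  prob_unique_out_arc R n <= potential n.-1%:R n n 0 / n%:R.
Proof.
move=> n3; rewrite prob_unique_out_arcE.
(* For an empty set of orderings the quotient would be 0 by convention, so no ordering has to be
   exhibited. *)
have [->|c0] := eqVneq #|{: arc_order n}|%:R (0 : R).
  rewrite mul0r invr0 mulr0 divr_ge0 // /potential !mul0r !add0r.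
  have N2 : 2 <= n.-1%:R :> R by rewrite ler_nat; lia.
  apply: mulr_ge0 => //; rewrite !addr_ge0 ?divr_ge0 ?invr_ge0 ?sumr_ge0 //; lra.
have c_gt0 : 0 < #|{: arc_order n}|%:R :> R by rewrite lt0r c0 ler0n.
rewrite invfM mulrA; apply: ler_wpM2r; first by rewrite invr_ge0.
rewrite ler_pdivrMr // mulrC.
have -> : potential n.-1%:R n n 0 = arc_potential (finset.set0 : {set arc n}) :> R.
  rewrite /arc_potential !degree_set_empty.
  by rewrite cards0 cardsT card_ord.
apply: le_trans (sum_hitting_digraph_le _ (ltnW n3) (fun D => @arc_potential_drift R n D n3)).
apply: ler_sum => s _; rewrite /arc_potential.
have [_ /forallP good _] := hitting_timeP s (ltnW n3).
have -> : degree_set (@tail n) (hitting_digraph s) 0 = finset.set0.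
  by apply/setP => v; have /andP[_] := good v; rewrite !finset.inE lt0n => /negbTE.
have -> : degree_set (@head n) (hitting_digraph s) 0 = finset.set0.
  by apply/setP => v; have /andP[+ _] := good v; rewrite !finset.inE lt0n => /negbTE.
(* With a = b = 0 the potential is x + x / (N - 1), which dominates x. *)
rewrite cards0 /potential !mul0r addr0 add0r invr1 mulr1 lerDl.
by rewrite divr_ge0 // subr_ge0 ler1n; lia.
Qed.

Lemma harmonic_sum_le_ln {R : realType} (m : nat) :
  harmonic_sum R m.+1 <= 1 + ln m.+1%:R.
Proof.
elim: m => [|m IH]; first by rewrite harmonic_sumS harmonic_sum0 ln1 invr1; lra.
rewrite harmonic_sumS.
have m1 : 0 < m.+1%:R :> R by rewrite ltr0n.
have m2 : 0 < m.+2%:R :> R by rewrite ltr0n.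
(* Equivalently, 1 / (m + 2) <= ln (m + 2) - ln (m + 1). *)
have : ln (1 + - m.+2%:R^-1) <= - m.+2%:R^-1 :> R.
  by apply: le_ln1Dx; rewrite ltrN2 invf_lt1 // ltr1n.
rewrite (_ : 1 + - _ = m.+1%:R / m.+2%:R); last first.
  apply: (mulIf (lt0r_neq0 m2)).
  by rewrite mulrBl mul1r mulVf ?divfK ?lt0r_neq0 // -[in LHS]natr1 addrK.
rewrite ln_div ?posrE //; move: IH.
move: (harmonic_sum R m.+1) (ln m.+1%:R) (ln m.+2%:R) (m.+2%:R^-1) => H l1 l2 i.
lra.
Qed.

Local Open Scope classical_set_scope.
Local Open Scope ring_scope.

Theorem theoremC (R : realType) :
  \forall n \near \oo, prob_unique_out_arc R n <= ln (n%:R) / n%:R.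
Proof.
near=> n.
have n4 : (4 <= n)%N by near: n; exact: nbhs_infty_ge.
(* The initial potential will be at most (3 + ln n) / 2 + 2 + 3, which is below ln n once ln n >=
   14. *)
have n_large : expR 14 <= n%:R :> R by near: n; exact: nbhs_infty_ger.
have n0 : 0 < n%:R :> R by rewrite ltr0n; lia.
have ln_large : 14 <= ln n%:R :> R by rewrite -[leLHS]expRK ler_ln ?posrE ?expR_gt0.
apply: le_trans (prob_unique_out_arc_le n (ltnW n4)) _.
apply: ler_wpM2r; first by rewrite invr_ge0 ltW.
rewrite /potential !mul0r !add0r.
have H2n : harmonic_sum R (n + n) <= 1 + (ln 2 + ln n%:R).
  rewrite -lnM ?posrE // -natrM mul2n -addnn.
  by case: (n) n4 => // m _; exact: harmonic_sum_le_ln.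
have ln2 : ln 2 < 2 :> R by exact: ln_sublinear.
have -> : n.-1%:R = n%:R - 1 :> R by rewrite -subn1 natrB //; lia.
have n4R : 4 <= n%:R :> R by rewrite ler_nat.
rewrite natrD; move: (n%:R : R) (harmonic_sum R (n + n)) n0 ln_large H2n n4R => y H y0 ln_large H2n y4.
rewrite (_ : y * _ = H / 2 + y / (y - 2) + 2 * y / (y - 1)); last first.
  by field; rewrite !lt0r_neq0 //; lra.
have : y / (y - 2) <= 2 by rewrite ler_pdivrMr; lra.
have : 2 * y / (y - 1) <= 3 by rewrite ler_pdivrMr; lra.
lra.
Unshelve. all: by end_near.
Qed.
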